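(* Let $\gamma$ be an $s$-curve with modulus $\mathbf e$ (with associated constants $a,b,c,\lambda$) and with momentum $\mathfrak m=\begin{pmatrix}-\lambda&0\\0&\lambda\end{pmatrix}$. Then $$\widehat\gamma(s,t)=\exp\!\Big(\mathrm i\big(\mathfrak m-\tfrac14 b\,\mathrm{Id}_{2\times2}\big)t\Big)\,\gamma(s-at)$$ is the evolution of $\gamma$ by the flow of $\mathbf Z_1$, i.e. $\widehat\gamma(s,0)=\gamma(s)$ and $$\frac{\partial\widehat\gamma}{\partial t}=\big(\tfrac12\widehat k^2-4\big)\widehat\gamma_s+\widehat k_s(\mathrm i\widehat\gamma_s)+2\widehat k(\mathrm i\widehat\gamma),$$ where $\widehat k(s,t)$ is the curvature of $\widehat\gamma(\cdot,t)$.
   Context: $S^3\subset\mathbb C^2$ is the set of unit vectors for the standard Hermitian inner product $\langle\cdot,\cdot\rangle$ (linear in the first slot). A unit-speed Legendrian curve is a smooth $\gamma:\mathbb R\to S^3$ with $\langle\gamma_s,\gamma\rangle=0$, $\langle\gamma_s,\gamma_s\rangle=1$; its curvature is $k=\mathrm{Im}\langle\gamma_{ss},\gamma_s\rangle$, and its moving frame is the $\mathrm U(2)$-valued matrix $\Gamma=(\gamma\ \ \gamma_s)$ with columns $\gamma,\gamma_s$. An $s$-curve is a unit-speed Legendrian curve whose curvature $k$ is a non-constant periodic solution of $k'''+\frac32k^2k'+ak'=0$ for some $a\in\mathbb R$. Then there are constants $b,c\in\mathbb R$ with $k''+\frac12k^3+ak+\frac12b=0$ and $(k')^2+P_{a,b,c}(k)=0$,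 where $P_{a,b,c}(x)=\frac14x^4+ax^2+bx+c$. Two cases are considered: the dnoidal case, where $P_{a,b,c}$ has four distinct real roots $e_1>e_2>e_3>e_4=-(e_1+e_2+e_3)$; and the cnoidal case, where $P_{a,b,c}$ has exactly two distinct real roots $e_1>e_2$ and complex conjugate roots $-\frac12(e_1+e_2)\pm\mathrm i e_3$ with $e_3>0$. In each case $\mathbf e=(e_1,e_2,e_3)$ is the modulus, and it determines $a,b,c$. One normalizes $k(0)=e_2$ (so $k$ oscillates between $e_2$ and $e_1$). Put $\lambda=\tfrac14\sqrt{256-128a+16a^2+b^2-16c}>0$ and $$\mathtt H=\begin{pmatrix}2k+\frac14b&k'+\mathrm i(\frac12k^2+a-4)\\ k'-\mathrm i(\frac12k^2+a-4)&-2k-\frac14b\end{pmatrix}.$$ The matrix $\Gamma\,\mathtt H\,\Gamma^{-1}$ is a constant traceless Hermitian matrix with eigenvalues $\pm\lambda$, called the momentum $\mathfrak m$ of $\gamma$ (multiplying $\gamma$ by a suitable element of $\mathrm U(2)$ puts it in the diagonal form used in the claim). *)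

(* Defs.v *)
From HB Require Import structures.
From mathcomp Require Import all_boot all_order all_algebra.
From mathcomp Require Import complex.
From mathcomp Require Import all_classical all_reals all_analysis.
Set Implicit Arguments.
Unset Strict Implicit.
Unset Printing Implicit Defensive.
Import Order.TTheory GRing.Theory Num.Theory.
Import numFieldNormedType.Exports.

Local Open Scope classical_set_scope.
Local Open Scope ring_scope.
Local Open Scope complex_scope.

(* R[i] carries no normed R-module structure in the libraries, so calculus for
   curves in C^n is done on the real and imaginary parts of the coordinates. *)
Definition vderivable (R : realType) n (f : R -> 'cV[R[i]]_n) (s : R) : Prop :=
  forall j, derivable (fun x => complex.Re (f x j 0)) s 1 /\
            derivable (fun x => complex.Im (f x j 0)) s 1.

(* Total, like derive1; meaningful where vderivable holds. *)
Definition vderive (R : realType) n (f : R -> 'cV[R[i]]_n) (s : R) :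
    'cV[R[i]]_n :=
  \col_j (derive1 (fun x => complex.Re (f x j 0)) s +i*
          derive1 (fun x => complex.Im (f x j 0)) s).

Definition vsmooth (R : realType) n (f : R -> 'cV[R[i]]_n) : Prop :=
  forall (m : nat) (s : R), vderivable (iter m (@vderive R n) f) s.

Definition herm (R : realType) n (u v : 'cV[R[i]]_n) : R[i] :=
  \sum_j u j 0 * (v j 0)^*.

Definition mx2 (T : Type) (x y z w : T) : 'M[T]_2 :=
  \matrix_(i, j) if i == 0 then (if j == 0 then x else y)
                 else (if j == 0 then z else w).

(* Exponential series, with convergence taken on the real and imaginary parts
   of each entry. *)
Definition expmx (R : realType) n (A : 'M[R[i]]_n.+1) : 'M[R[i]]_n.+1 :=
  let S (N : nat) := \sum_(k < N) (k`!%:R)^-1 *: A ^+ k in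
  \matrix_(i, j) (lim (complex.Re (S N i j) @[N --> \oo]) +i*
                  lim (complex.Im (S N i j) @[N --> \oo])).

Record unit_speed_legendrian (R : realType) (g : R -> 'cV[R[i]]_2) : Prop := {
  usl_smooth : vsmooth g;
  usl_sphere : forall s, herm (g s) (g s) = 1;
  usl_legendrian : forall s, herm (vderive g s) (g s) = 0;
  usl_unit_speed : forall s, herm (vderive g s) (vderive g s) = 1 }.

Definition curvature (R : realType) (g : R -> 'cV[R[i]]_2) (s : R) : R :=
  complex.Im (herm (vderive (vderive g) s) (vderive g s)).

Definition frame (R : realType) (g : R -> 'cV[R[i]]_2) (s : R) : 'M[R[i]]_2 :=
  row_mx (g s) (vderive g s).

Definition s_curve_ode (R : realType) (k : R -> R) (a : R) : Prop :=
  forall s,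
    derive1n 3 k s + 3 / 2 * k s ^+ 2 * derive1 k s + a * derive1 k s = 0.

Record s_curve (R : realType) (g : R -> 'cV[R[i]]_2) : Prop := {
  scurve_usl : unit_speed_legendrian g;
  scurve_nonconst : exists s1 s2, curvature g s1 <> curvature g s2;
  scurve_periodic :
    exists2 T, 0 < T & forall s, curvature g (s + T) = curvature g s;
  scurve_ode : exists a, s_curve_ode (curvature g) a }.

Definition quartic (R : realType) (a b c : R) : {poly R} :=
  4^-1 *: 'X^4 + a *: 'X^2 + b *: 'X + c%:P.

Definition s_curve_constants (R : realType) (g : R -> 'cV[R[i]]_2)
    (a b c : R) : Prop :=
  let k := curvature g in
  [/\ s_curve_ode k a,
      forall s, derive1n 2 k s + k s ^+ 3 / 2 + a * k s + b / 2 = 0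
    & forall s, derive1 k s ^+ 2 + (quartic a b c).[k s] = 0].

Definition dnoidal_modulus (R : realType) (a b c e1 e2 e3 : R) : Prop :=
  let e4 := - (e1 + e2 + e3) in
  [/\ e1 > e2, e2 > e3, e3 > e4
    & all (root (quartic a b c)) [:: e1; e2; e3; e4]].

Definition cnoidal_modulus (R : realType) (a b c e1 e2 e3 : R) : Prop :=
  let P := quartic a b c in
  let PC := map_poly (real_complex R) P in
  [/\ e1 > e2,
      forall x, root P x = (x == e1) || (x == e2),
      e3 > 0,
      root PC ((- (e1 + e2) / 2) +i* e3)
    & root PC ((- (e1 + e2) / 2) +i* (- e3))].

(* The normalization k(0) = e2 places k in the oscillation range [e2, e1]. *)
Definition has_modulus (R : realType) (g : R -> 'cV[R[i]]_2)
    (a b c e1 e2 e3 : R) : Prop :=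
  [/\ s_curve_constants g a b c,
      dnoidal_modulus a b c e1 e2 e3 \/ cnoidal_modulus a b c e1 e2 e3
    & curvature g 0 = e2].

Definition lambda (R : realType) (a b c : R) : R :=
  Num.sqrt (256 - 128 * a + 16 * a ^+ 2 + b ^+ 2 - 16 * c) / 4.

Definition Hmx (R : realType) (g : R -> 'cV[R[i]]_2) (a b s : R) :
    'M[R[i]]_2 :=
  let k := curvature g in
  let p := 2 * k s + b / 4 in
  let q := k s ^+ 2 / 2 + a - 4 in
  mx2 p%:C (derive1 k s +i* q) (derive1 k s +i* (- q)) (- p)%:C.

(* frame * H * frame^-1 is independent of s along an s-curve with constants
   a and b; its constant value is read off at s = 0. *)
Definition momentum (R : realType) (g : R -> 'cV[R[i]]_2) (a b : R) :
    'M[R[i]]_2 :=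
  frame g 0 *m Hmx g a b 0 *m invmx (frame g 0).

Definition Z1 (R : realType) (g : R -> 'cV[R[i]]_2) (s : R) : 'cV[R[i]]_2 :=
  let k := curvature g in
  (k s ^+ 2 / 2 - 4)%:C *: vderive g s
  + (derive1 k s)%:C *: ('i *: vderive g s)
  + (2 * k s)%:C *: ('i *: g s).

Record Z1_evolution (R : realType) (g : R -> 'cV[R[i]]_2)
    (G : R -> R -> 'cV[R[i]]_2) : Prop := {
  Z1_usl : forall t, unit_speed_legendrian (fun s => G s t);
  Z1_init : forall s, G s 0 = g s;
  Z1_derivable : forall s t, vderivable (G s) t;
  Z1_flow : forall s t, vderive (G s) t = Z1 (fun x => G x t) s }.

(* Main.v *)
Require Import Defs.
From mathcomp Require Import all_boot all_order all_algebra.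
From mathcomp Require Import complex ring.
From mathcomp Require Import all_classical all_reals all_analysis.
Import GRing.Theory Num.Theory.
Import numFieldNormedType.Exports.
Set Implicit Arguments.
Unset Strict Implicit.
Local Open Scope ring_scope.
Local Open Scope complex_scope.

(** An s-curve moves under the flow by rotating rigidly while its parameter is
    translated, and the momentum is the generator of the rotation.

    Write [F] for the moving frame, with columns the curve [g] and its velocity,
    [K] for the matrix of its Frenet equation [F' = F K], and [H] for the
    Hermitian matrix in the definition of the momentum. The second-order equation
    for the curvature [k] is equivalent to the Lax equation [H' = H K - K H]
    ([Hmx_derive]). As [K] is skew-Hermitian and [F] is unitary, [F H F^-1] is
    constant ([momentum_frame]), hence equal everywhere to its value [m] at the
    origin. The first column of [m F = F H], multiplied by [i] after [b / 4] has
    been subtracted from [m], reads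
      [i (m - b/4) g = 2 k (i g) + k' (i g') + (k^2/2 + a - 4) g']
    ([momentum_curve]): the infinitesimal rotation of the curve is the field [Z1]
    plus [a] times the velocity.

    For [E t = exp (i t (m - b/4))] the time derivative of [E t *m g (s - a t)] is
    [E t] applied to [i (m - b/4) g - a g'], so the translation at speed [a]
    removes the extra term and leaves [E t] applied to the field of [g]. Finally
    [E t] is diagonal with entries of modulus one ([expmx_imag_diag],
    [phase_mx_unitary]); unitary matrices preserve the Hermitian product, hence
    unit-speed Legendrian curves and their curvature, and the field commutes with
    them ([Z1_motion]). The right-hand side is therefore the field of the moved
    curve. *)

(** * Calculus of complex matrix-valued functions *)

(** The derivative is taken on real and imaginary parts, to agree with [vderive];
    the relational form composes without differentiability side conditions. *)
Definition is_cderive {R : realType} (f : R -> R[i]) (s : R) (l : R[i]) :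
    Prop :=
  is_derive s 1 (fun x => complex.Re (f x)) (complex.Re l) /\
  is_derive s 1 (fun x => complex.Im (f x)) (complex.Im l).

Lemma is_cderive_cst {R : realType} (z : R[i]) (s : R) :
  is_cderive (fun=> z) s 0.
Proof. by split; exact: is_derive_cst. Qed.

Lemma is_cderive_real {R : realType} (f : R -> R) (s l : R) :
  is_derive s 1 f l -> is_cderive (fun x => (f x)%:C) s l%:C.
Proof. by split=> //; exact: is_derive_cst. Qed.

Lemma is_cderiveD {R : realType} (f g : R -> R[i]) (s : R) (df dg : R[i]) :
  is_cderive f s df -> is_cderive g s dg ->
  is_cderive (fun x => f x + g x) s (df + dg).
Proof.
move=> [f1 f2] [g1 g2]; split; rewrite raddfD/=.
  have -> : (fun x => complex.Re (f x + g x)) =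
    (fun x => complex.Re (f x)) + (fun x => complex.Re (g x)).
    by apply/funext => x; rewrite raddfD.
  exact: is_deriveD.
have -> : (fun x => complex.Im (f x + g x)) =
    (fun x => complex.Im (f x)) + (fun x => complex.Im (g x)).
  by apply/funext => x; rewrite raddfD.
exact: is_deriveD.
Qed.

Lemma is_cderiveM {R : realType} (f g : R -> R[i]) (s : R) (df dg : R[i]) :
  is_cderive f s df -> is_cderive g s dg ->
  is_cderive (fun x => f x * g x) s (df * g s + f s * dg).
Proof.
move=> [f1 f2] [g1 g2].
have ReD (u v : R[i]) : complex.Re (u + v) = complex.Re u + complex.Re v.
  by case: u v => [? ?] [? ?].
have ImD (u v : R[i]) : complex.Im (u + v) = complex.Im u + complex.Im v.
  by case: u v => [? ?] [? ?].
have ReM (u v : R[i]) : complex.Re (u * v) =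
    complex.Re u * complex.Re v - complex.Im u * complex.Im v.
  by case: u v => [? ?] [? ?].
have ImM (u v : R[i]) : complex.Im (u * v) =
    complex.Re u * complex.Im v + complex.Im u * complex.Re v.
  by case: u v => [? ?] [? ?].
split.
  have -> : (fun x => complex.Re (f x * g x)) =
    (fun x => complex.Re (f x)) * (fun x => complex.Re (g x)) -
    (fun x => complex.Im (f x)) * (fun x => complex.Im (g x)).
    by apply/funext => x; rewrite ReM.
  apply: (is_derive_eq (is_deriveB (is_deriveM f1 g1) (is_deriveM f2 g2))).
  by rewrite ReD !ReM /GRing.scale/=; ring.
have -> : (fun x => complex.Im (f x * g x)) =
    (fun x => complex.Re (f x)) * (fun x => complex.Im (g x)) +
    (fun x => complex.Im (f x)) * (fun x => complex.Re (g x)).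
  by apply/funext => x; rewrite ImM.
apply: (is_derive_eq (is_deriveD (is_deriveM f1 g2) (is_deriveM f2 g1))).
by rewrite ImD !ImM /GRing.scale/=; ring.
Qed.

Lemma is_cderive_conj {R : realType} (f : R -> R[i]) (s : R) (df : R[i]) :
  is_cderive f s df -> is_cderive (fun x => (f x)^*%R) s df^*%R.
Proof.
have ReJ (u : R[i]) : complex.Re u^*%R = complex.Re u by case: u.
have ImJ (u : R[i]) : complex.Im u^*%R = - complex.Im u by case: u.
move=> [f1 f2]; split; rewrite ?ReJ ?ImJ.
  by under eq_fun do rewrite ReJ.
under eq_fun do rewrite ImJ.
exact: is_deriveN.
Qed.

(** Covers a shift of the arc length, the travelling argument [s - a * t] and the
    phase of a rotation at constant speed. *)
Lemma is_cderive_comp_affine {R : realType} (f : R -> R[i]) (u v s : R)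
    (df : R[i]) :
  is_cderive f (u + v * s) df ->
  is_cderive (fun x => f (u + v * x)) s (v%:C * df).
Proof.
move=> [f1 f2].
have aff : is_derive s 1 (fun x : R => u + v * x) v.
  apply: (is_derive_eq (is_deriveD (is_derive_cst u s 1)
    (is_deriveZ v (is_derive_id s 1)))).
  by rewrite add0r [LHS]mulr1.
have E : v%:C * df = (v * complex.Re df) +i* (v * complex.Im df).
  by case: df {f1 f2} => x y; simpc.
split; rewrite E /= mulrC.
  exact: (@is_derive1_comp _ (fun x => complex.Re (f x)) (fun x => u + v * x)).
exact: (@is_derive1_comp _ (fun x => complex.Im (f x)) (fun x => u + v * x)).
Qed.

Lemma is_cderive_sum {R : realType} (n : nat) (f : 'I_n -> R -> R[i]) (s : R)
    (df : 'I_n -> R[i]) :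
  (forall i, is_cderive (f i) s (df i)) ->
  is_cderive (fun x => \sum_i f i x) s (\sum_i df i).
Proof.
elim: n f df => [|n IH] f df h.
  rewrite big_ord0; under eq_fun do rewrite big_ord0.
  exact: is_cderive_cst.
rewrite big_ord_recl; under eq_fun do rewrite big_ord_recl.
by apply: is_cderiveD => //; apply: IH.
Qed.

Lemma is_cderive0_cst {R : realType} (f : R -> R[i]) :
  (forall s, is_cderive f s 0) -> forall s t, f s = f t.
Proof.
move=> f0 s t.
have hr : complex.Re (f s) = complex.Re (f t).
  apply: (@is_derive_0_is_cst _ (fun x => complex.Re (f x))) => x.
  by case: (f0 x).
have hi : complex.Im (f s) = complex.Im (f t).
  apply: (@is_derive_0_is_cst _ (fun x => complex.Im (f x))) => x.
  by case: (f0 x).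
by case: (f s) (f t) hr hi => [? ?] [? ?] /= -> ->.
Qed.

(** Turns the pointwise identities defining a Legendrian curve into identities
    between derivatives. *)
Lemma is_cderive_cst_eq0 {R : realType} (f : R -> R[i]) (z : R[i]) (s : R) df :
  (forall x, f x = z) -> is_cderive f s df -> df = 0.
Proof.
move=> fz; rewrite (funext fz) => -[[_ h1] [_ h2]].
move: h1 h2; rewrite !derive_cst.
by case: df => ? ? /= <- <-.
Qed.

Lemma is_cderive_Im {R : realType} (f : R -> R[i]) s df :
  is_cderive f s df ->
  is_derive s 1 (fun x => complex.Im (f x)) (complex.Im df).
Proof. by case. Qed.

Lemma is_derive_derive1 {R : realType} (f f' : R -> R) :
  (forall s : R, is_derive s 1 f (f' s)) -> derive1 f = f'.
Proof.
by move=> h; apply/funext => s; have hs := h s; rewrite derive1E derive_val.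
Qed.

Definition is_mxderive {R : realType} {p q : nat} (f : R -> 'M[R[i]]_(p, q))
    (s : R) (l : 'M[R[i]]_(p, q)) : Prop :=
  forall i j, is_cderive (fun x => f x i j) s (l i j).

Lemma is_mxderive_eq {R : realType} {p q : nat} (A : R -> 'M[R[i]]_(p, q))
    s dA dB :
  is_mxderive A s dA -> dA = dB -> is_mxderive A s dB.
Proof. by move=> h <-. Qed.

Lemma is_mxderive_cst {R : realType} {p q : nat} (A : 'M[R[i]]_(p, q)) (s : R) :
  is_mxderive (fun=> A) s 0.
Proof. by move=> i j; rewrite mxE; exact: is_cderive_cst. Qed.

Lemma is_mxderiveM {R : realType} {p q r : nat} (A : R -> 'M[R[i]]_(p, q))
    (B : R -> 'M[R[i]]_(q, r)) (s : R) dA dB :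
  is_mxderive A s dA -> is_mxderive B s dB ->
  is_mxderive (fun x => A x *m B x) s (dA *m B s + A s *m dB).
Proof.
move=> hA hB i j; rewrite !mxE -big_split/=.
under eq_fun do rewrite mxE.
by apply: is_cderive_sum => l; exact: is_cderiveM (hA i l) (hB l j).
Qed.

Lemma is_mxderiveMl {R : realType} {p q r : nat} (E : 'M[R[i]]_(p, q))
    (A : R -> 'M[R[i]]_(q, r)) (s : R) dA :
  is_mxderive A s dA -> is_mxderive (fun x => E *m A x) s (E *m dA).
Proof.
move=> h; apply: is_mxderive_eq (is_mxderiveM (is_mxderive_cst E s) h) _.
by rewrite mul0mx add0r.
Qed.

Lemma is_mxderive_comp_affine {R : realType} {p q : nat}
    (A : R -> 'M[R[i]]_(p, q)) (u v s : R) dA :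
  is_mxderive A (u + v * s) dA ->
  is_mxderive (fun x => A (u + v * x)) s (v%:C *: dA).
Proof.
by move=> hA i j; rewrite mxE; exact: is_cderive_comp_affine (hA i j).
Qed.

Lemma is_mxderive_shift {R : realType} {p q : nat} (A : R -> 'M[R[i]]_(p, q))
    (tau s : R) dA :
  is_mxderive A (s - tau) dA -> is_mxderive (fun x => A (x - tau)) s dA.
Proof.
have E (x : R) : x - tau = - tau + 1 * x by rewrite mul1r addrC.
rewrite E => /is_mxderive_comp_affine; rewrite scale1r.
by under eq_fun do rewrite -E.
Qed.

Lemma is_mxderive0_cst {R : realType} {p q : nat} (A : R -> 'M[R[i]]_(p, q)) :
  (forall s, is_mxderive A s 0) -> forall s t, A s = A t.
Proof.
move=> A0 s t; apply/matrixP => i j.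
have Aij x : is_cderive (fun y => A y i j) x 0 by have := A0 x i j; rewrite mxE.
exact: is_cderive0_cst Aij s t.
Qed.

Lemma is_mxderive_row_mx {R : realType} {p q r : nat}
    (A : R -> 'M[R[i]]_(p, q)) (B : R -> 'M[R[i]]_(p, r)) (s : R) dA dB :
  is_mxderive A s dA -> is_mxderive B s dB ->
  is_mxderive (fun x => row_mx (A x) (B x)) s (row_mx dA dB).
Proof.
move=> hA hB i j; rewrite mxE; under eq_fun do rewrite mxE.
by case: (fintype.split j) => l.
Qed.

Lemma is_mxderiveP {R : realType} {n : nat} (f : R -> 'cV[R[i]]_n) (s : R) l :
  is_mxderive f s l <-> vderivable f s /\ vderive f s = l.
Proof.
split=> [h|[h <-] i j].
  split=> [j|]; first by case: (h j 0) => [[? _] [? _]].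
  apply/matrixP => j i; rewrite !mxE ord1 !derive1E.
  by case: (h j 0) => h1 h2; rewrite !derive_val; case: (l j 0).
rewrite mxE ord1; case: (h i) => h1 h2; split=> /=.
  by rewrite derive1E; exact: derivableP.
by rewrite derive1E; exact: derivableP.
Qed.

Lemma vsmooth_is_mxderive {R : realType} {n : nat} (f : R -> 'cV[R[i]]_n) :
  vsmooth f -> forall s, is_mxderive f s (vderive f s).
Proof. by move=> fs s; apply/is_mxderiveP; split=> //; exact: (fs 0%N). Qed.

Lemma vsmooth_vderive {R : realType} {n : nat} (f : R -> 'cV[R[i]]_n) :
  vsmooth f -> vsmooth (vderive f).
Proof. by move=> fs m s; rewrite -iterSr; exact: fs. Qed.

(** * Two-by-two matrices by entries *)

Lemma mx2_ext {T : Type} (A B : 'M[T]_2) :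
  A 0 0 = B 0 0 -> A 0 1 = B 0 1 -> A 1 0 = B 1 0 -> A 1 1 = B 1 1 -> A = B.
Proof.
move=> h00 h01 h10 h11; apply/matrixP => i j.
have ord2 (l : 'I_2) : l = 0 \/ l = 1.
  by case: l => [[|[|//]] ?]; [left|right]; exact/val_inj.
by case: (ord2 i) => ->; case: (ord2 j) => ->.
Qed.

Lemma cV2_ext {T : Type} (u v : 'cV[T]_2) :
  u 0 0 = v 0 0 -> u 1 0 = v 1 0 -> u = v.
Proof.
move=> h0 h1; apply/matrixP => i j; rewrite ord1.
case: i => [[|[|//]] ?].
  by rewrite (_ : Ordinal _ = 0)//; exact/val_inj.
by rewrite (_ : Ordinal _ = 1)//; exact/val_inj.
Qed.

Lemma sum2E {V : nmodType} (F : 'I_2 -> V) : \sum_i F i = F 0 + F 1.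
Proof. by rewrite big_ord_recl big_ord1; congr (_ + F _); exact/val_inj. Qed.

Lemma mulmx_mx2 {K : pzRingType} (x y z w x' y' z' w' : K) :
  mx2 x y z w *m mx2 x' y' z' w' =
  mx2 (x * x' + y * z') (x * y' + y * w') (z * x' + w * z') (z * y' + w * w').
Proof. by apply: mx2_ext; rewrite !mxE sum2E !mxE. Qed.

Lemma addmx_mx2 {K : pzRingType} (x y z w x' y' z' w' : K) :
  mx2 x y z w + mx2 x' y' z' w' = mx2 (x + x') (y + y') (z + z') (w + w').
Proof. by apply: mx2_ext; rewrite !mxE. Qed.

Lemma oppmx_mx2 {K : pzRingType} (x y z w : K) :
  - mx2 x y z w = mx2 (- x) (- y) (- z) (- w).
Proof. by apply: mx2_ext; rewrite !mxE. Qed.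

Lemma scale_mx2 {K : pzRingType} (a x y z w : K) :
  a *: mx2 x y z w = mx2 (a * x) (a * y) (a * z) (a * w).
Proof. by apply: mx2_ext; rewrite !mxE. Qed.

Lemma mx2_1 {K : pzRingType} : 1%:M = mx2 1 0 0 1 :> 'M[K]_2.
Proof. by apply: mx2_ext; rewrite !mxE. Qed.

Lemma expr_diag_mx2 {K : pzRingType} (x y : K) n :
  mx2 x 0 0 y ^+ n = mx2 (x ^+ n) 0 0 (y ^+ n).
Proof.
elim: n => [|n IH]; first by rewrite -mx2_1.
by rewrite exprS IH -mulmxE mulmx_mx2 !mul0r !mulr0 !addr0 add0r -!exprS.
Qed.

Lemma row_mx2E {K : pzRingType} (u v : 'cV[K]_2) i j :
  (row_mx u v : 'M[K]_2) i j = if j == 0 then u i 0 else v i 0.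
Proof.
rewrite mxE; case: splitP => l; rewrite !ord1 => /= jl.
  by rewrite (_ : j == 0)//; exact/eqP/val_inj.
by case: eqP jl => // ->.
Qed.

Lemma mul_row_mx2 {K : comPzRingType} (u v : 'cV[K]_2) (x y z w : K) :
  row_mx u v *m mx2 x y z w = row_mx (x *: u + z *: v) (y *: u + w *: v).
Proof.
apply: mx2_ext; rewrite row_mx2E mxE sum2E !row_mx2E !mxE /=.
all: by congr (_ + _); exact: mulrC.
Qed.

Lemma is_mxderive_mx2 {R : realType} (x y z w : R -> R[i]) (s : R) dx dy dz dw :
  is_cderive x s dx -> is_cderive y s dy ->
  is_cderive z s dz -> is_cderive w s dw ->
  is_mxderive (fun u => mx2 (x u) (y u) (z u) (w u)) s (mx2 dx dy dz dw).
Proof.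
move=> hx hy hz hw i j; rewrite mxE; under eq_fun do rewrite mxE.
by case: (i == 0); case: (j == 0).
Qed.

(** * Adjoints and the Hermitian product *)

Definition adjmx {R : realType} {p q : nat} (A : 'M[R[i]]_(p, q)) :
  'M[R[i]]_(q, p) := map_mx Num.conj A^T.

Lemma adjmxE {R : realType} {p q : nat} (A : 'M[R[i]]_(p, q)) i j :
  adjmx A i j = (A j i)^*%R.
Proof. by rewrite !mxE. Qed.

Lemma adjmxM {R : realType} {p q r : nat} (A : 'M[R[i]]_(p, q))
    (B : 'M[R[i]]_(q, r)) : adjmx (A *m B) = adjmx B *m adjmx A.
Proof. by rewrite /adjmx trmx_mul map_mxM. Qed.

Lemma adjmx_mx2 {R : realType} (x y z w : R[i]) :
  adjmx (mx2 x y z w) = mx2 x^*%R z^*%R y^*%R w^*%R.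
Proof. by apply: mx2_ext; rewrite !mxE. Qed.

Lemma is_mxderive_adj {R : realType} {p q : nat} (A : R -> 'M[R[i]]_(p, q))
    (s : R) dA :
  is_mxderive A s dA -> is_mxderive (fun x => adjmx (A x)) s (adjmx dA).
Proof.
move=> hA i j; rewrite !mxE; under eq_fun do rewrite !mxE.
exact: is_cderive_conj (hA j i).
Qed.

Lemma herm_adjmx {R : realType} {n : nat} (u v : 'cV[R[i]]_n) :
  herm u v = (adjmx v *m u) 0 0.
Proof. by rewrite mxE; apply: eq_bigr => j _; rewrite !mxE mulrC. Qed.

Lemma herm_mulmx {R : realType} {n : nat} (E : 'M[R[i]]_n) (u v : 'cV[R[i]]_n) :
  adjmx E *m E = 1%:M -> herm (E *m u) (E *m v) = herm u v.
Proof.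
by move=> EE; rewrite !herm_adjmx adjmxM -mulmxA (mulmxA _ E) EE mul1mx.
Qed.

Lemma herm_conj {R : realType} {n : nat} (u v : 'cV[R[i]]_n) :
  herm v u = (herm u v)^*%R.
Proof.
rewrite /herm rmorph_sum; apply: eq_bigr => j _.
by rewrite rmorphM/= conjCK mulrC.
Qed.

Lemma is_cderive_herm {R : realType} {n : nat} (u v : R -> 'cV[R[i]]_n)
    s du dv :
  is_mxderive u s du -> is_mxderive v s dv ->
  is_cderive (fun x => herm (u x) (v x)) s (herm du (v s) + herm (u s) dv).
Proof.
move=> hu hv; rewrite /herm -big_split/=.
apply: is_cderive_sum => j.
exact: is_cderiveM (hu j 0) (is_cderive_conj (hv j 0)).
Qed.

Lemma gram_row_mx {R : realType} (u v : 'cV[R[i]]_2) :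
  adjmx (row_mx u v) *m row_mx u v =
  mx2 (herm u u) (herm v u) (herm u v) (herm v v).
Proof.
apply: mx2_ext; rewrite [LHS]mxE sum2E !adjmxE !row_mx2E !mxE /= [RHS]sum2E.
all: by congr (_ + _); exact: mulrC.
Qed.

Lemma orthonormal_unitary {R : realType} (u v : 'cV[R[i]]_2) :
  herm u u = 1 -> herm v v = 1 -> herm v u = 0 ->
  adjmx (row_mx u v) *m row_mx u v = 1%:M.
Proof.
move=> uu vv vu.
by rewrite gram_row_mx (herm_conj v u) uu vv vu conjC0 mx2_1.
Qed.

(** A left inverse of a square matrix is a right inverse: the Gram matrix of
    [u], [v] being the identity makes [u], [v] a basis with dual coordinates
    given by the Hermitian product. *)
Lemma orthonormal_expansion {R : realType} (u v w : 'cV[R[i]]_2) :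
  herm u u = 1 -> herm v v = 1 -> herm v u = 0 ->
  w = herm w u *: u + herm w v *: v.
Proof.
move=> uu vv vu; have /mulmx1C UU := orthonormal_unitary uu vv vu.
rewrite -{1}[w]mul1mx -UU -mulmxA.
have h0 : (adjmx (row_mx u v) *m w) 0 0 = herm w u.
  by rewrite herm_adjmx ![LHS]mxE ![RHS]mxE !sum2E !adjmxE !row_mx2E.
have h1 : (adjmx (row_mx u v) *m w) 1 0 = herm w v.
  by rewrite herm_adjmx ![LHS]mxE ![RHS]mxE !sum2E !adjmxE !row_mx2E.
apply: cV2_ext; rewrite mxE sum2E !row_mx2E /= h0 h1 !mxE.
all: by rewrite !(mulrC (herm _ _)).
Qed.

(** * The moving frame and the conservation of momentum *)

Ltac complex_field :=
  apply/eqP; rewrite eq_complex; apply/andP; split; simpc => //=;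
  by apply/eqP; field.

(** The curvature is built from the first two derivatives of [g], so the
    smoothness of [g] lets it be differentiated twice. *)
Lemma curvature_derive {R : realType} (g : R -> 'cV[R[i]]_2) : vsmooth g ->
  (forall s : R, is_derive s 1 (curvature g) (derive1 (curvature g) s)) /\
  (forall s : R,
     is_derive s 1 (derive1 (curvature g)) (derive1n 2 (curvature g) s)).
Proof.
move=> s0; have s1 := vsmooth_vderive s0; have s2 := vsmooth_vderive s1.
have s3 := vsmooth_vderive s2.
have h1 := vsmooth_is_mxderive s1; have h2 := vsmooth_is_mxderive s2.
have h3 := vsmooth_is_mxderive s3.
have k1 s := is_cderive_Im (is_cderive_herm (h2 s) (h1 s)).
have k2 s := is_cderive_Im
  (is_cderiveD (is_cderive_herm (h3 s) (h1 s))
               (is_cderive_herm (h2 s) (h2 s))).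
have e1 := is_derive_derive1 k1; have e2 := is_derive_derive1 k2.
split=> s; first by rewrite {2}/curvature e1; exact: k1.
by rewrite derive1nS /derive1n /= /curvature e1 e2; exact: k2.
Qed.

(** Differentiating the Legendrian condition gives the component of the
    acceleration along [g], differentiating the unit-speed condition shows that
    the component along the velocity is purely imaginary, and there is no third
    direction. *)
Lemma frenet {R : realType} (g : R -> 'cV[R[i]]_2) (s : R) :
  unit_speed_legendrian g ->
  vderive (vderive g) s = - g s + (0 +i* curvature g s) *: vderive g s.
Proof.
case=> gs gg g'g g'g'.
have h0 := vsmooth_is_mxderive gs.
have h1 := vsmooth_is_mxderive (vsmooth_vderive gs).
have leg : herm (vderive (vderive g) s) (g s) = -1.
  have := is_cderive_cst_eq0 g'g (is_cderive_herm (h1 s) (h0 s)).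
  by rewrite g'g' => /eqP; rewrite addr_eq0 => /eqP.
have acc : herm (vderive (vderive g) s) (vderive g s) = 0 +i* curvature g s.
  have := is_cderive_cst_eq0 g'g' (is_cderive_herm (h1 s) (h1 s)).
  rewrite (herm_conj (vderive (vderive g) s)) /curvature.
  case: (herm _ _) => x y [+ _] /=.
  by rewrite -mulr2n => /eqP; rewrite mulrn_eq0 /= => /eqP ->.
rewrite [LHS](orthonormal_expansion _ (gg s) (g'g' s) (g'g s)).
by rewrite leg acc scaleN1r.
Qed.

(** The matrix [K] of the frame equation: the derivative of the frame [F] is
    [F *m K]. *)
Definition frenet_mx {R : realType} (k : R) : 'M[R[i]]_2 :=
  mx2 0 (- 1) 1 (0 +i* k).

Lemma adj_frenet_mx {R : realType} (k : R) :
  adjmx (frenet_mx k) = - frenet_mx k.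
Proof.
rewrite adjmx_mx2 oppmx_mx2; congr mx2; apply/eqP; rewrite eq_complex;
  by apply/andP; split; simpc; rewrite /= ?oppr0 ?mulN1r ?opprK.
Qed.

Lemma frame_derive {R : realType} (g : R -> 'cV[R[i]]_2) (s : R) :
  unit_speed_legendrian g ->
  is_mxderive (frame g) s (frame g s *m frenet_mx (curvature g s)).
Proof.
move=> hg; have gs := usl_smooth hg.
have h0 := vsmooth_is_mxderive gs s.
have h1 := vsmooth_is_mxderive (vsmooth_vderive gs) s.
apply: (is_mxderive_eq (is_mxderive_row_mx h0 h1)).
by rewrite mul_row_mx2 scale0r add0r scale1r scaleN1r frenet.
Qed.

Lemma frame_unitary {R : realType} (g : R -> 'cV[R[i]]_2) (s : R) :
  unit_speed_legendrian g -> adjmx (frame g s) *m frame g s = 1%:M.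
Proof. by case=> _ gg g'g g'g'; exact: orthonormal_unitary. Qed.

(** The Lax form of the curvature equation: the derivative of [H] is the
    commutator of [H] and [K]. The diagonal entries hold by themselves; the
    off-diagonal ones are the second-order equation for the curvature. *)
Lemma Hmx_derive {R : realType} (g : R -> 'cV[R[i]]_2) (a b s : R) :
  vsmooth g ->
  derive1n 2 (curvature g) s + curvature g s ^+ 3 / 2
     + a * curvature g s + b / 2 = 0 ->
  is_mxderive (Hmx g a b) s
    (Hmx g a b s *m frenet_mx (curvature g s) -
     frenet_mx (curvature g s) *m Hmx g a b s).
Proof.
move=> /curvature_derive[h1 h2]; have := h1 s; have := h2 s => {h1 h2}.
set k := curvature g; set k1 := derive1 k; set k2 := derive1n 2 k.
move=> d2 d1 ode.
have dq : is_derive s 1 (fun x : R => k x ^+ 2 / 2 + a - 4) (k s * k1 s).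
  have -> : (fun x : R => k x ^+ 2 / 2 + a - 4) = 2^-1 *: (k * k) + cst (a - 4).
    by apply/funext => x; rewrite -addrA expr2 mulrC.
  apply: (is_derive_eq (is_deriveD (is_deriveZ (2^-1) (is_deriveM d1 d1))
    (is_derive_cst (a - 4) s 1))).
  by rewrite addr0 /GRing.scale/=; field.
have dNq :
    is_derive s 1 (fun x : R => - (k x ^+ 2 / 2 + a - 4)) (- (k s * k1 s)).
  exact: (is_deriveN dq).
have dp : is_derive s 1 (fun x : R => 2 * k x + b / 4) (2 * k1 s).
  apply: (is_derive_eq (is_deriveD (is_deriveZ (2 : R) d1)
    (is_derive_cst (b / 4) s 1))).
  by rewrite addr0.
have dNp : is_derive s 1 (fun x : R => - (2 * k x + b / 4)) (- (2 * k1 s)).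
  exact: (is_deriveN dp).
apply: (is_mxderive_eq (dA := mx2 (2 * k1 s)%:C (k2 s +i* (k s * k1 s))
   (k2 s +i* (- (k s * k1 s))) (- (2 * k1 s))%:C)).
  by apply: is_mxderive_mx2; [exact: is_cderive_real| split | split |
    exact: is_cderive_real].
have -> : k2 s = - (k s ^+ 3 / 2 + a * k s + b / 2).
  by apply/eqP; rewrite -subr_eq0 opprK !addrA; apply/eqP.
rewrite /Hmx /frenet_mx !mulmx_mx2 oppmx_mx2 addmx_mx2 -/k -/k1.
by congr mx2; complex_field.
Qed.

(** Since the frame [F] is unitary, [F *m H *m F^-1] can be written with the
    adjoint of [F], which is easy to differentiate. As [K] is skew-Hermitian, the
    Lax equation makes all the terms of its derivative cancel. *)
Lemma momentum_frame {R : realType} (g : R -> 'cV[R[i]]_2) (a b : R) :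
  unit_speed_legendrian g ->
  (forall s, derive1n 2 (curvature g) s + curvature g s ^+ 3 / 2
     + a * curvature g s + b / 2 = 0) ->
  forall s, momentum g a b *m frame g s = frame g s *m Hmx g a b s.
Proof.
move=> hg ode s.
have U x := frame_unitary x hg.
pose M x := frame g x *m Hmx g a b x *m adjmx (frame g x).
have M0 x : is_mxderive M x 0.
  have dF := frame_derive x hg.
  have dH := Hmx_derive (usl_smooth hg) (ode x).
  have dM := is_mxderiveM (is_mxderiveM dF dH) (is_mxderive_adj dF).
  apply: (is_mxderive_eq dM).
  rewrite adjmxM adj_frenet_mx mulmxBr mulmxDl.
  rewrite !mulmxDl !mulNmx !mulmxN !mulmxA.
  by rewrite (addrCA (_ *m _ *m _ *m _)) subrr addr0 subrr.
have <- : M s = momentum g a b.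
  rewrite (is_mxderive0_cst M0 s 0) /M /momentum.
  suff -> : adjmx (frame g 0) = invmx (frame g 0) by [].
  have /mulmx1_unit[_ Fu] := U 0.
  by rewrite -[LHS]mulmx1 -(mulmxV Fu) mulmxA U mul1mx.
by rewrite /M -mulmxA U mulmx1.
Qed.

(** The first column of [m *m F = F *m H]: applied to the curve, the momentum
    becomes a combination of position and velocity with coefficients in the
    curvature, as in [Z1]. *)
Lemma momentum_curve {R : realType} (g : R -> 'cV[R[i]]_2) (a b : R) :
  unit_speed_legendrian g ->
  (forall s, derive1n 2 (curvature g) s + curvature g s ^+ 3 / 2
     + a * curvature g s + b / 2 = 0) ->
  forall s, momentum g a b *m g s =
    (2 * curvature g s + b / 4)%:C *: g s
    + (derive1 (curvature g) s +i* - (curvature g s ^+ 2 / 2 + a - 4)) *: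
      vderive g s.
Proof.
move=> hg ode s; have := momentum_frame hg ode s.
rewrite /Hmx mul_row_mx2.
rewrite [LHS](mul_mx_row (momentum g a b) (g s) (vderive g s)).
by case/(@eq_row_mx _ _ 1 1).
Qed.

(** * The exponential of an imaginary diagonal matrix *)

Definition cis {R : realType} (x : R) : R[i] := cos x +i* sin x.

Lemma is_cderive_cis {R : realType} (v s : R) :
  is_cderive (fun t => cis (v * t)) s ((0 +i* v) * cis (v * s)).
Proof.
have h :
    is_cderive (@cis R) (0 + v * s) ((- sin (0 + v * s)) +i* cos (0 + v * s)).
  by split; [exact: is_derive_cos | exact: is_derive_sin].
have := is_cderive_comp_affine h; rewrite add0r.
under eq_fun do rewrite add0r.
by congr is_cderive; rewrite /cis; complex_field.
Qed.

Lemma cis_unit {R : realType} (x : R) : (cis x)^*%R * cis x = 1.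
Proof.
have c2 := cos2Dsin2 x.
apply/eqP; rewrite eq_complex; apply/andP; split; rewrite /cis/=; simpc => /=;
  apply/eqP; last by ring.
by rewrite -c2; ring.
Qed.

(** The coefficients are those of the real sine and cosine series, with parity
    indicators in place of a case distinction. *)
Lemma expr_imag {R : realType} (x : R) (n : nat) :
  (0 +i* x) ^+ n = ((~~ odd n)%:R * (-1) ^+ n./2 * x ^+ n) +i*
                   ((odd n)%:R * (-1) ^+ n.-1./2 * x ^+ n) :> R[i].
Proof.
elim: n => [|n IH]; first by rewrite /= !mul0r !mul1r.
rewrite exprS IH; case: n {IH} => [|n].
  by complex_field.
by rewrite /= !negbK !exprS; case: (odd n) => /=; complex_field.
Qed.

Lemma Re_sum {R : realType} {I : Type} (r : seq I) (P : pred I)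
    (F : I -> R[i]) :
  complex.Re (\sum_(k <- r | P k) F k) = \sum_(k <- r | P k) complex.Re (F k).
Proof. by elim/big_rec2: _ => // i x y _ <-; case: (F i) y => ? ? []. Qed.

Lemma Im_sum {R : realType} {I : Type} (r : seq I) (P : pred I)
    (F : I -> R[i]) :
  complex.Im (\sum_(k <- r | P k) F k) = \sum_(k <- r | P k) complex.Im (F k).
Proof. by elim/big_rec2: _ => // i x y _ <-; case: (F i) y => ? ? []. Qed.

Lemma exp_term_imag {R : realType} (x : R) (n : nat) :
  (n`!%:R)^-1 * (0 +i* x) ^+ n = cos_coeff x n +i* sin_coeff x n :> R[i].
Proof.
have -> : (n`!%:R)^-1 = ((n`!%:R)^-1)%:C :> R[i] by rewrite fmorphV rmorph_nat.
rewrite expr_imag /cos_coeff /sin_coeff /=; simpc.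
by congr (_ +i* _); exact: mulrC.
Qed.

(** Cosine and sine are by definition the limits of the series of
    [cos_coeff] and [sin_coeff], which are the real and imaginary parts of the
    exponential series: the partial sums agree term by term. *)
Lemma expmx_imag_diag {R : realType} (x y : R) :
  expmx (mx2 (0 +i* x) 0 0 (0 +i* y)) = mx2 (cis x) 0 0 (cis y).
Proof.
have Smx N : \sum_(k < N) (k`!%:R)^-1 *: mx2 (0 +i* x) 0 0 (0 +i* y) ^+ k =
    mx2 (\sum_(k < N) cos_coeff x k +i* sin_coeff x k) 0
        0 (\sum_(k < N) cos_coeff y k +i* sin_coeff y k).
  elim: N => [|N IH]; first by rewrite !big_ord0; apply: mx2_ext; rewrite !mxE.
  rewrite !big_ord_recr/= IH expr_diag_mx2 scale_mx2 addmx_mx2.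
  by rewrite !mulr0 !addr0 !exp_term_imag.
have limcos z : lim (complex.Re (\sum_(k < N) cos_coeff z k +i* sin_coeff z k)
    @[N --> \oo])%classic = cos z.
  rewrite (_ : (fun N => _) = series (cos_coeff z)) ?cos.unlock//.
  by apply/funext => N; rewrite Re_sum seriesEord.
have limsin z : lim (complex.Im (\sum_(k < N) cos_coeff z k +i* sin_coeff z k)
    @[N --> \oo])%classic = sin z.
  rewrite (_ : (fun N => _) = series (sin_coeff z)) ?sin.unlock//.
  by apply/funext => N; rewrite Im_sum seriesEord.
have lim0 : lim ((0 : R) @[_ --> \oo])%classic = 0 by exact: lim_cst.
apply: mx2_ext; rewrite !mxE; under [in X in X +i* _]eq_fun do rewrite Smx mxE.
all: under [in X in _ +i* X]eq_fun do rewrite Smx mxE.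
all: by rewrite /= ?limcos ?limsin ?lim0.
Qed.

(** Replaces the imaginary unit of a closed field by a pair, so that identities
    can be computed on real and imaginary parts. *)
Lemma imaginaryE {R : realType} : Num.imaginary = (0 +i* 1) :> R[i].
Proof. by []. Qed.

Definition phase_mx {R : realType} (x y : R) : 'M[R[i]]_2 :=
  mx2 (cis x) 0 0 (cis y).

Lemma phase_mx_unitary {R : realType} (x y : R) :
  adjmx (phase_mx x y) *m phase_mx x y = 1%:M.
Proof.
rewrite /phase_mx adjmx_mx2 mulmx_mx2 !conjC0 !mul0r !mulr0 !addr0 !add0r.
by rewrite !cis_unit mx2_1.
Qed.

Lemma is_mxderive_phase_mx {R : realType} (x y t : R) :
  is_mxderive (fun u => phase_mx (x * u) (y * u)) t
    (phase_mx (x * t) (y * t) *m mx2 (0 +i* x) 0 0 (0 +i* y)).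
Proof.
apply: is_mxderive_eq (is_mxderive_mx2 (is_cderive_cis x t) (is_cderive_cst 0 t)
   (is_cderive_cst 0 t) (is_cderive_cis y t)) _.
by rewrite mulmx_mx2 !mul0r !mulr0 !addr0 !add0r ![_ * cis _]mulrC.
Qed.

(** * Unitary motions combined with a shift of the arc length *)

Lemma vderive_motion {R : realType} {n : nat} (E : 'M[R[i]]_n)
    (f : R -> 'cV[R[i]]_n) (tau : R) :
  vsmooth f ->
  vderive (fun s => E *m f (s - tau)) = fun s => E *m vderive f (s - tau).
Proof.
move=> fs; apply/funext => s.
by have /is_mxderiveP[] := is_mxderiveMl E
  (is_mxderive_shift (vsmooth_is_mxderive fs (s - tau))).
Qed.

Lemma vsmooth_motion {R : realType} {n : nat} (E : 'M[R[i]]_n)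
    (f : R -> 'cV[R[i]]_n) (tau : R) :
  vsmooth f -> vsmooth (fun s => E *m f (s - tau)).
Proof.
move=> fs m; elim: m f fs => [|m IH] f fs s.
  by have /is_mxderiveP[] := is_mxderiveMl E
    (is_mxderive_shift (vsmooth_is_mxderive fs (s - tau))).
by rewrite iterSr vderive_motion//; apply: IH; exact: vsmooth_vderive.
Qed.

Lemma unit_speed_legendrian_motion {R : realType} (E : 'M[R[i]]_2)
    (g : R -> 'cV[R[i]]_2) (tau : R) :
  adjmx E *m E = 1%:M -> unit_speed_legendrian g ->
  unit_speed_legendrian (fun s => E *m g (s - tau)).
Proof.
move=> EE [gs gg g'g g'g']; split; rewrite ?vderive_motion//.
- exact: vsmooth_motion.
- by move=> s; rewrite herm_mulmx.
- by move=> s; rewrite herm_mulmx.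
- by move=> s; rewrite herm_mulmx.
Qed.

Lemma curvature_motion {R : realType} (E : 'M[R[i]]_2) (g : R -> 'cV[R[i]]_2)
    (tau : R) :
  adjmx E *m E = 1%:M -> vsmooth g ->
  curvature (fun s => E *m g (s - tau)) = fun s => curvature g (s - tau).
Proof.
move=> EE gs; apply/funext => s; rewrite /curvature.
by rewrite !vderive_motion ?herm_mulmx//; exact: vsmooth_vderive.
Qed.

(** The field is built from the curve, its velocity and its curvature by real
    and imaginary scalings, so it is equivariant under unitary matrices. *)
Lemma Z1_motion {R : realType} (E : 'M[R[i]]_2) (g : R -> 'cV[R[i]]_2)
    (tau s : R) :
  adjmx E *m E = 1%:M -> vsmooth g ->
  Z1 (fun x => E *m g (x - tau)) s = E *m Z1 g (s - tau).
Proof.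
move=> EE gs; rewrite /Z1 curvature_motion// vderive_motion//.
have -> : derive1 (fun x => curvature g (x - tau)) s =
    derive1 (curvature g) (s - tau).
  have [dk _] := curvature_derive gs.
  have dshift : is_derive s 1 (fun x : R => x - tau) 1.
    apply: is_derive_eq (is_deriveB (is_derive_id s 1) (is_derive_cst tau s 1)) _.
    by rewrite subr0.
  have [_ dcomp] := @is_derive1_comp _ _ (fun x => x - tau) _ _ _ (dk _) dshift.
  by rewrite derive1E dcomp mulr1.
by rewrite !mulmxDr -!scalemxAr.
Qed.

(** * The evolution of an s-curve *)

Theorem proposition4p5 (R : realType) (g : R -> 'cV[R[i]]_2)
    (a b c e1 e2 e3 : R) (m : 'M[R[i]]_2)
    (hg : s_curve g)
    (he : has_modulus g a b c e1 e2 e3)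
    (hm : momentum g a b = m)
    (hdiag : m = mx2 (- lambda a b c)%:C 0 0 (lambda a b c)%:C) :
  Z1_evolution g
    (fun s t => expmx (('i * t%:C) *: (m - ((b / 4)%:C)%:M)) *m g (s - a * t)).
Proof.
have usl := scurve_usl hg; have gs := usl_smooth usl.
have [[_ ode _] _ _] := he.
set l := lambda a b c in hdiag.
have iM : 'i *: (m - ((b / 4)%:C)%:M) =
    mx2 (0 +i* (- l - b / 4)) 0 0 (0 +i* (l - b / 4)).
  rewrite hdiag imaginaryE -scalemx1 mx2_1.
  rewrite scale_mx2 oppmx_mx2 addmx_mx2 scale_mx2.
  by congr mx2; complex_field.
pose E t := phase_mx ((- l - b / 4) * t) ((l - b / 4) * t).
have expE t : expmx (('i * t%:C) *: (m - ((b / 4)%:C)%:M)) = E t.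
  rewrite mulrC -scalerA iM scale_mx2 !mulr0 /E /phase_mx -expmx_imag_diag.
  have tI z : t%:C * (0 +i* z) = 0 +i* (z * t) by complex_field.
  by rewrite !tI.
under eq_fun do under eq_fun do rewrite expE.
have dG s t :
    is_mxderive (fun t => E t *m g (s - a * t)) t (E t *m Z1 g (s - a * t)).
  have dg : is_mxderive (fun t => g (s - a * t)) t
      ((- a)%:C *: vderive g (s - a * t)).
    under eq_fun do rewrite -mulNr.
    rewrite -mulNr; apply: is_mxderive_comp_affine.
    exact: vsmooth_is_mxderive.
  apply: is_mxderive_eq (is_mxderiveM (is_mxderive_phase_mx _ _ t) dg) _.
  rewrite -mulmxA -mulmxDr; congr (_ *m _).
  (* The rotation and translation terms add up to [Z1] by the column identity
     for the momentum. *)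
  rewrite -iM -scalemxAl mulmxBl mul_scalar_mx -hm momentum_curve// /Z1.
  rewrite imaginaryE.
  move: (g _) (vderive g _) (curvature g _) (derive1 _ _) => u v k k1.
  apply/matrixP => i j; rewrite !mxE.
  by case: (u i j) (v i j) => u1 u2 [v1 v2]; complex_field.
have EU t : adjmx (E t) *m E t = 1%:M by exact: phase_mx_unitary.
split=> [t|s|s t|s t] /=.
- exact: (@unit_speed_legendrian_motion _ _ g (a * t)) (EU t) usl.
- by rewrite /E !mulr0 subr0 /phase_mx /cis cos0 sin0 -mx2_1 mul1mx.
- by have /is_mxderiveP[] := dG s t.
- by rewrite Z1_motion//; have /is_mxderiveP[] := dG s t.
Qed.
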